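(* Let $R$ be a ring, let $M$ be a left $R$-module and $n\geq 1$ an integer. Then the following statements are equivalent: (1) $\mathrm{pd}_R(M)\leq n$; (2) $\mathrm{Ext}^{n+1}_R(M,N)=0$ for each $\mathcal F_1$-flat left $R$-module $N$; (3) $\mathrm{Ext}^{n+1}_R(M,N)=0$ for each $\mathcal F_1^{\mathrm{fp}}$-flat left $R$-module $N$.
   Context: $R$ is an associative ring with unit and modules are unital. $\mathrm{pd}_R$ denotes projective dimension. $\mathcal F_1$ is the class of right $R$-modules of flat dimension at most $1$; $\mathcal F_1^{\mathrm{fp}}$ is its subclass of finitely presented modules. A left $R$-module $N$ is $\mathcal F_1$-flat (resp. $\mathcal F_1^{\mathrm{fp}}$-flat) if $\mathrm{Tor}_1^R(H,N)=0$ for every $H\in\mathcal F_1$ (resp. $H\in\mathcal F_1^{\mathrm{fp}}$). *)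

(* Defs.v *)
From HB Require Import structures.
From mathcomp Require Import all_boot all_order all_algebra.
From mathcomp Require Import generic_quotient ring_quotient.
From mathcomp Require Import finmap boolp classical_sets functions cardinality.
From mathcomp Require Import fsbigop.

Set Implicit Arguments.
Unset Strict Implicit.
Unset Printing Implicit Defensive.

Import GRing.Theory.
Local Open Scope ring_scope.
Local Open Scope quotient_scope.
Local Open Scope classical_set_scope.

(* A right R-module is a left module over the opposite ring R^c; for         *)
(* r : R and h in such a module, h.r is written (r : R^c) *: h.              *)
Notation rmodType R := (lmodType R^c).

Section Kernel.
Variables (A B : zmodType) (f : {additive A -> B}).

Definition ker_pred : {pred A} := [pred a | f a == 0].

Lemma ker_pred_closed : zmod_closed ker_pred.
Proof.
split=> [|x y]; rewrite !inE ?raddf0 // => /eqP fx /eqP fy.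
by rewrite raddfB fx fy subrr.
Qed.

HB.instance Definition _ := GRing.isZmodClosed.Build A ker_pred ker_pred_closed.

Record kernel := Kernel { kernel_val : A; _ : kernel_val \in ker_pred }.

HB.instance Definition _ := [isSub for kernel_val].
HB.instance Definition _ := [Choice of kernel by <:].
HB.instance Definition _ := [SubChoice_isSubZmodule of kernel by <:].

End Kernel.

Section LinearKernel.
Variables (R : pzRingType) (U V : lmodType R) (f : {linear U -> V}).

Lemma ker_pred_submod_closed : submod_closed (ker_pred f).
Proof.
split=> [|a x y]; rewrite !inE ?raddf0 // => /eqP fx /eqP fy.
by apply/eqP; rewrite [LHS](linearP f a x y) fx fy scaler0 addr0.
Qed.

HB.instance Definition _ :=
  GRing.isSubmodClosed.Build R U (ker_pred f) ker_pred_submod_closed.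
HB.instance Definition _ := [SubZmodule_isSubLmodule of kernel f by <:].

End LinearKernel.

Section Homology.
Variables (A B C : zmodType) (f : {additive A -> B}) (g : {additive B -> C}).

Definition boundary_pred : {pred kernel g} :=
  [pred z | `[< exists a, f a = val z >]].

Lemma boundary_pred_closed : zmod_closed boundary_pred.
Proof.
split=> [|x y].
  by apply/asboolP; exists 0; rewrite !raddf0.
move=> /asboolP[a fa] /asboolP[b fb]; apply/asboolP; exists (a - b).
by rewrite !raddfB /= fa fb.
Qed.

HB.instance Definition _ :=
  GRing.isZmodClosed.Build (kernel g) boundary_pred boundary_pred_closed.

(* ker g / im f for a complex A -> B -> C *)
Definition homology : zmodType := Quotient.quot boundary_pred.

End Homology.

Section FreeModule.
Variables (R : pzRingType) (X : choiceType).

Definition finsupp_pred : {pred X -> R^o} :=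
  [pred a | `[< finite_set (a @^-1` [set~ 0]) >]].

Lemma finsupp_pred_closed : submod_closed finsupp_pred.
Proof.
split=> [|r a b /asboolP fa /asboolP fb]; apply/asboolP.
  by apply: (sub_finite_set _ (finite_set0 X)) => x /=; apply.
apply: (sub_finite_set _ (_ : finite_set
  ((a @^-1` [set~ 0]) `|` (b @^-1` [set~ 0])))); last by rewrite finite_setU.
move=> x /= abx; have [ax|/eqP ax] := eqVneq (a x) 0; last by left.
by right=> bx; apply: abx; rewrite /GRing.add /= /GRing.scale /= ax bx scaler0 addr0.
Qed.

HB.instance Definition _ :=
  GRing.isSubmodClosed.Build R (X -> R^o) finsupp_pred finsupp_pred_closed.

(* free left R-module on the set X: finitely supported functions X -> R *)
Record free_mod :=
  FreeMod { free_coef : X -> R^o; _ : free_coef \in finsupp_pred }.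

HB.instance Definition _ := [isSub for free_coef].
HB.instance Definition _ := [Choice of free_mod by <:].
HB.instance Definition _ := [SubChoice_isSubLmodule of free_mod by <:].

Lemma free_gen_subproof (x : X) :
  (fun y => (y == x)%:R : R^o) \in finsupp_pred.
Proof.
apply/asboolP; apply: (sub_finite_set _ (finite_set1 x)) => y /= nz.
by apply/eqP; apply: contra_notT nz => /negbTE ->.
Qed.

Definition free_gen (x : X) : free_mod := FreeMod (free_gen_subproof x).

Section Lift.
Variables (M : lmodType R) (f : X -> M).

Definition free_lift (a : free_mod) : M :=
  \sum_(x \in [set: X]) (free_coef a x : R) *: f x.

Lemma free_lift_seq (A : {fset X}) (a : free_mod) :
  (forall x, x \notin A -> free_coef a x = 0) ->
  free_lift a = \sum_(x <- A) (free_coef a x : R) *: f x.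
Proof. by move=> aA; apply: fsbigTE => x /aA ->; rewrite scale0r. Qed.

Lemma free_finsupp (a : free_mod) :
  exists A : {fset X}, forall x, x \notin A -> free_coef a x = 0.
Proof.
have /asboolP fin := valP a; exists (fset_set (free_coef a @^-1` [set~ 0])).
by move=> x; rewrite in_fset_set // notin_setE /= => /contrapT.
Qed.

Lemma free_lift_linear : linear free_lift.
Proof.
move=> r a b; have [[A aA] [B bB]] := (free_finsupp a, free_finsupp b).
have a0 x : x \notin (A `|` B)%fset -> free_coef a x = 0.
  by rewrite in_fsetU negb_or => /andP[/aA].
have b0 x : x \notin (A `|` B)%fset -> free_coef b x = 0.
  by rewrite in_fsetU negb_or => /andP[_ /bB].
have abE x : free_coef (r *: a + b) x = r * free_coef a x + free_coef b x by [].
rewrite (free_lift_seq a0) (free_lift_seq b0) (@free_lift_seq (A `|` B)%fset).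
  rewrite scaler_sumr -big_split /=; apply: eq_bigr => x _.
  rewrite -[LHS]/((r * free_coef a x + free_coef b x : R) *: f x).
  by rewrite scalerDl scalerA.
by move=> x xAB; rewrite [LHS]abE a0 // b0 // mulr0 addr0.
Qed.

HB.instance Definition _ :=
  GRing.isLinear.Build R free_mod M _ free_lift free_lift_linear.

Lemma free_lift_gen (x : X) : free_lift (free_gen x) = f x.
Proof.
rewrite (@free_lift_seq [fset x]%fset) => [|y]; last first.
  by rewrite in_fset1 /= => /negbTE ->.
by rewrite big_seq_fset1 /= eqxx scale1r.
Qed.

End Lift.

Lemma free_gen_decomp (A : {fset X}) (a : free_mod) :
  (forall x, x \notin A -> free_coef a x = 0) ->
  a = \sum_(x <- A) (free_coef a x : R) *: free_gen x.
Proof.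
move=> aA; apply: val_inj; apply/funext => y.
have -> : val (\sum_(x <- A) (free_coef a x : R) *: free_gen x) y
    = \sum_(x <- A) (free_coef a x : R) * (y == x)%:R.
  by rewrite raddf_sum fct_sumE.
have [yA|yA] := boolP (y \in A); last first.
  rewrite [LHS]aA // big_seq big1 // => x xA; case: eqP => [yx|_].
    by rewrite yx xA in yA.
  by rewrite mulr0.
rewrite (big_fsetD1 y) //= eqxx mulr1 big_seq big1 ?addr0 // => x.
by rewrite in_fsetD1 eq_sym => /andP[/negbTE -> _]; rewrite mulr0.
Qed.

End FreeModule.

Section Hom.
Variables (R : pzRingType) (U V : lmodType R).

Definition hom_pred : {pred U -> V} := [pred f | `[< linear f >]].

Lemma hom_pred_closed : zmod_closed hom_pred.
Proof.
split=> [|f g /asboolP lf /asboolP lg]; apply/asboolP=> a x y.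
  by rewrite /GRing.zero /= scaler0 addr0.
rewrite -[LHS]/(f (a *: x + y) - g (a *: x + y)).
rewrite -[RHS]/(a *: (f x - g x) + (f y - g y)).
by rewrite lf lg scalerBr opprD addrACA.
Qed.

HB.instance Definition _ :=
  GRing.isZmodClosed.Build (U -> V) hom_pred hom_pred_closed.

(* Hom_R(U, V) as an abelian group *)
Record linhom := LinHom { hom_fun :> U -> V; _ : hom_fun \in hom_pred }.

HB.instance Definition _ := [isSub for hom_fun].
HB.instance Definition _ := [Choice of linhom by <:].
HB.instance Definition _ := [SubChoice_isSubZmodule of linhom by <:].

Lemma hom_linear (f : linhom) : linear f.
Proof. by apply/asboolP; exact: (valP f). Qed.

HB.instance Definition _ (f : linhom) :=
  GRing.isLinear.Build R U V _ (hom_fun f) (hom_linear f).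

End Hom.

Section HomPrecomp.
Variables (R : pzRingType) (U U' V : lmodType R) (d : {linear U' -> U}).

Lemma hom_precomp_subproof (f : linhom U V) : (f \o d) \in @hom_pred R U' V.
Proof. by apply/asboolP=> a x y /=; rewrite !linearP. Qed.

Definition hom_precomp (f : linhom U V) : linhom U' V := LinHom (hom_precomp_subproof f).

Lemma hom_precomp_additive : zmod_morphism hom_precomp.
Proof. by move=> f g; apply: val_inj. Qed.

HB.instance Definition _ :=
  GRing.isZmodMorphism.Build (linhom U V) (linhom U' V) hom_precomp
    hom_precomp_additive.

End HomPrecomp.

Section Tensor.
Variables (R : pzRingType) (H : rmodType R) (N : lmodType R).
Let F := free_mod int (H * N)%type.
Let gen (h : H) (x : N) : F := free_gen int (h, x).

(* the subgroup generated by the bilinearity and balancing relations *)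
Inductive tensor_rel : F -> Prop :=
| tensor_rel0 : tensor_rel 0
| tensor_relB u v : tensor_rel u -> tensor_rel v -> tensor_rel (u - v)
| tensor_rel_addl h h' x :
    tensor_rel (gen (h + h') x - (gen h x + gen h' x))
| tensor_rel_addr h x x' :
    tensor_rel (gen h (x + x') - (gen h x + gen h x'))
| tensor_rel_bal (r : R) h x :
    tensor_rel (gen ((r : R^c) *: h) x - gen h (r *: x)).

Definition tensor_pred : {pred F} := [pred u | `[< tensor_rel u >]].

Lemma tensor_pred_closed : zmod_closed tensor_pred.
Proof.
split=> [|u v /asboolP tu /asboolP tv]; apply/asboolP; first exact: tensor_rel0.
exact: tensor_relB.
Qed.

HB.instance Definition _ :=
  GRing.isZmodClosed.Build F tensor_pred tensor_pred_closed.

Definition tensor : zmodType := Quotient.quot tensor_pred.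

Definition tensor_pi (u : F) : tensor := \pi_(Quotient.quot tensor_pred) u.

Lemma tensor_piB : zmod_morphism tensor_pi.
Proof. by move=> u v; rewrite /tensor_pi raddfB. Qed.

HB.instance Definition _ :=
  GRing.isZmodMorphism.Build F tensor tensor_pi tensor_piB.

Lemma tensor_pi_eq0 (u : F) : tensor_rel u -> tensor_pi u = 0.
Proof.
move=> tu; rewrite -[RHS](raddf0 tensor_pi); apply/eqP.
by rewrite /tensor_pi -Quotient.idealrBE subr0; apply/asboolP.
Qed.

(* the pure tensor h (x) x *)
Definition tens (h : H) (x : N) : tensor := tensor_pi (gen h x).

Definition tensor_repr (t : tensor) : F :=
  repr (t : Quotient.quot tensor_pred).

Lemma tensor_reprK t : tensor_pi (tensor_repr t) = t.
Proof. exact: reprK. Qed.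

Lemma tensor_repr_pi u : tensor_rel (tensor_repr (tensor_pi u) - u).
Proof.
suff /asboolP : tensor_repr (tensor_pi u) - u \in tensor_pred by [].
rewrite Quotient.idealrBE; apply/eqP; exact: reprK.
Qed.

Lemma tens_addl h h' x : tens (h + h') x = tens h x + tens h' x.
Proof.
apply/eqP; rewrite -subr_eq0 -raddfD -raddfB; apply/eqP/tensor_pi_eq0.
exact: tensor_rel_addl.
Qed.

Lemma tens_addr h x x' : tens h (x + x') = tens h x + tens h x'.
Proof.
apply/eqP; rewrite -subr_eq0 -raddfD -raddfB; apply/eqP/tensor_pi_eq0.
exact: tensor_rel_addr.
Qed.

Lemma tens_bal (r : R) h x : tens ((r : R^c) *: h) x = tens h (r *: x).
Proof.
apply/eqP; rewrite -subr_eq0 -raddfB; apply/eqP/tensor_pi_eq0.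
exact: tensor_rel_bal.
Qed.

End Tensor.

Section TensorMap.
Variables (R : pzRingType) (H H' : rmodType R) (N N' : lmodType R).
Variables (f : {linear H -> H'}) (g : {linear N -> N'}).

Let gen (p : H * N) : free_mod int (H' * N')%type :=
  free_gen int (f p.1, g p.2).
Let phi (u : free_mod int (H * N)%type) : tensor H' N' :=
  tensor_pi (free_lift gen u).

Let phiB u v : phi (u - v) = phi u - phi v.
Proof. by rewrite /phi !raddfB. Qed.

Let phiD u v : phi (u + v) = phi u + phi v.
Proof. by rewrite /phi !raddfD. Qed.

Let phi_gen h x : phi (free_gen int (h, x)) = tens (f h) (g x).
Proof. by rewrite /phi free_lift_gen. Qed.

Let phi_rel u : tensor_rel u -> phi u = 0.
Proof.
elim=> [|v w _ v0 _ w0|h h' x|h x x'|r h x].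
- by rewrite /phi !raddf0.
- by rewrite phiB v0 w0 subrr.
- by rewrite phiB phiD !phi_gen raddfD tens_addl subrr.
- by rewrite phiB phiD !phi_gen raddfD tens_addr subrr.
- by rewrite phiB !phi_gen !linearZ /= tens_bal subrr.
Qed.

(* f (x) g, i.e. the additive map sending h (x) x to f h (x) g x *)
Definition tensor_map (t : tensor H N) : tensor H' N' :=
  tensor_pi (free_lift gen (tensor_repr t)).

Let tensor_map_pi u : tensor_map (tensor_pi u) = phi u.
Proof.
by apply/eqP; rewrite -subr_eq0 -phiB; apply/eqP/phi_rel/tensor_repr_pi.
Qed.

Lemma tensor_map_tens h x : tensor_map (tens h x) = tens (f h) (g x).
Proof. by rewrite tensor_map_pi phi_gen. Qed.

Lemma tensor_map_additive : zmod_morphism tensor_map.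
Proof.
move=> t s; rewrite -[t]tensor_reprK -[s]tensor_reprK -raddfB.
by rewrite !tensor_map_pi phiB.
Qed.

HB.instance Definition _ :=
  GRing.isZmodMorphism.Build (tensor H N) (tensor H' N') tensor_map
    tensor_map_additive.

End TensorMap.

Definition exact_at (R : pzRingType) (U V W : lmodType R)
    (f : {linear U -> V}) (g : {linear V -> W}) : Prop :=
  forall v, g v = 0 <-> exists u, f u = v.

(* ... -> P_2 -> P_1 -> P_0 -> M -> 0 exact, no condition on the P_i *)
Record resolution (R : pzRingType) (M : lmodType R) := Resolution {
  res_obj :> nat -> lmodType R;
  res_d : forall i, {linear res_obj i.+1 -> res_obj i};
  res_aug : {linear res_obj 0 -> M};
  res_aug_surj : forall m, exists x, res_aug x = m;
  res_exact0 : exact_at (res_d 0) res_aug;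
  res_exact : forall i, exact_at (res_d i.+1) (res_d i)
}.

(* The functorial free resolution: P_0 is free on the set M, and P_(i+1) is  *)
(* free on the underlying set of the i-th kernel (syzygy).                   *)
Section FreeResolution.
Variables (R : pzRingType) (M : lmodType R).

Definition free_cover (U : lmodType R) : {linear free_mod R U -> U} :=
  free_lift (@id U).

Lemma free_cover_surj U u : exists a, free_cover U a = u.
Proof. by exists (free_gen R u); apply: free_lift_gen. Qed.

Definition syz (U : lmodType R) : lmodType R := kernel (free_cover U).

Definition free_res_obj (i : nat) : lmodType R := free_mod R (iter i syz M).

Definition free_res_d (i : nat) : {linear free_res_obj i.+1 -> free_res_obj i} :=
  (val : {linear syz (iter i syz M) -> free_res_obj i})
    \o free_cover (syz (iter i syz M)).

Lemma syz_exact (U : lmodType R) :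
  exact_at ((val : {linear syz U -> free_mod R U}) \o free_cover (syz U))
    (free_cover U).
Proof.
move=> v; split=> [v0|[u <-] /=].
  have vK : v \in ker_pred (free_cover U) by apply/eqP.
  have [a fa] := free_cover_surj (Kernel vK : syz U).
  by exists a; apply: (congr1 val fa).
by apply/eqP; apply: (valP (free_cover (syz U) u)).
Qed.

Lemma free_res_exact i : exact_at (free_res_d i.+1) (free_res_d i).
Proof.
move=> v; rewrite -(syz_exact v); split=> [v0|v0]; last first.
  by rewrite /= [X in val X]v0.
by apply: val_inj; rewrite [LHS]v0.
Qed.

Definition free_resolution : resolution M :=
  @Resolution R M free_res_obj free_res_d (free_cover M)
    (@free_cover_surj M) (@syz_exact M) free_res_exact.

End FreeResolution.

Definition projective (R : pzRingType) (P : lmodType R) : Prop :=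
  forall (U V : lmodType R) (p : {linear U -> V}) (f : {linear P -> V}),
    (forall v, exists u, p u = v) ->
    exists g : {linear P -> U}, forall x, p (g x) = f x.

Definition flat (R : pzRingType) (F : rmodType R) : Prop :=
  forall (U V : lmodType R) (f : {linear U -> V}),
    injective f -> injective (tensor_map (idfun : {linear F -> F}) f).

(* pd_R(M) <= n: there is a projective resolution of length at most n *)
Definition pd_le (R : pzRingType) (M : lmodType R) (n : nat) : Prop :=
  exists P : resolution M,
    (forall i, projective (P i)) /\
    (forall i, (n < i)%N -> forall x : P i, x = 0).

(* fd_R(H) <= n: there is a flat resolution of length at most n *)
Definition fd_le (R : pzRingType) (H : rmodType R) (n : nat) : Prop :=
  exists F : resolution H,
    (forall i, flat (F i)) /\
    (forall i, (n < i)%N -> forall x : F i, x = 0).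

Lemma free_mod_projective (R : pzRingType) (X : choiceType) :
  projective (free_mod R X).
Proof.
move=> U V p f psurj.
pose g x := sval (cid (psurj (f (free_gen R x)))).
have pg x : p (g x) = f (free_gen R x) by rewrite /g; case: cid.
exists (free_lift g) => a; have [A aA] := free_finsupp a.
rewrite [X in p X](free_lift_seq _ aA) [in RHS](free_gen_decomp aA) !raddf_sum.
by apply: eq_bigr => x _; rewrite [LHS]linearZ [RHS]linearZ /= pg.
Qed.

Section Ext.
Variables (R : pzRingType) (M N : lmodType R).

Definition hom_d (i : nat) :
    {additive linhom (free_resolution M i) N -> linhom (free_resolution M i.+1) N} :=
  @hom_precomp R _ _ N (res_d (free_resolution M) i).

(* Ext^n_R(M, N): n-th cohomology of Hom_R(P, N), P the free resolution of M *)
Definition Ext (n : nat) : zmodType :=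
  if n is i.+1 then homology (hom_d i) (hom_d i.+1)
  else homology
    (\0 : {additive linhom (free_resolution M 0) N ->
                    linhom (free_resolution M 0) N}) (hom_d 0).

End Ext.

Section Tor.
Variables (R : pzRingType) (H : rmodType R) (N : lmodType R).

Definition tensor_d (i : nat) :
    {additive tensor (free_resolution H i.+1) N -> tensor (free_resolution H i) N} :=
  tensor_map (res_d (free_resolution H) i) idfun.

(* Tor_n^R(H, N): n-th homology of P (x)_R N, P the free resolution of H *)
Definition Tor (n : nat) : zmodType :=
  if n is i.+1 then homology (tensor_d i.+1) (tensor_d i)
  else homology (tensor_d 0)
    (\0 : {additive tensor (free_resolution H 0) N ->
                    tensor (free_resolution H 0) N}).

End Tor.

Definition is_zero (A : zmodType) : Prop := forall x : A, x = 0.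

(* there is an exact sequence R^m -> R^n -> M -> 0 *)
Definition fin_pres (R : pzRingType) (M : lmodType R) : Prop :=
  exists (m n : nat) (f : {linear 'rV[R]_m -> 'rV[R]_n})
         (g : {linear 'rV[R]_n -> M}),
    (forall x, exists y, g y = x) /\ exact_at f g.

Definition F1 (R : pzRingType) (H : rmodType R) : Prop := fd_le H 1.

Definition F1_fp (R : pzRingType) (H : rmodType R) : Prop :=
  F1 H /\ fin_pres H.

Definition F1_flat (R : pzRingType) (N : lmodType R) : Prop :=
  forall H : rmodType R, F1 H -> is_zero (Tor H N 1).

Definition F1_fp_flat (R : pzRingType) (N : lmodType R) : Prop :=
  forall H : rmodType R, F1_fp H -> is_zero (Tor H N 1).

(* Main.v *)
From HB Require Import structures.
Require Import Defs.
From mathcomp Require Import all_boot all_algebra.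
From mathcomp Require Import generic_quotient ring_quotient finmap boolp.

(** Write Omega U for the kernel of the free cover of U, and take
N = Omega^(n+1) M. If Ext^(n+1)(M, N) = 0, then the cover
F_(n+1) -> N, which is a cocycle, extends to F_n, giving a retraction of the
inclusion of N in F_n; hence Omega^n M is projective and pd M <= n. So it is
enough that a submodule K of a free module L be F1-flat. Classically
Tor_1(H, K) = Tor_2(H, L/K) = 0 when fd H <= 1. To avoid the long exact
sequence, we compare a flat resolution 0 -> G1 -> G0 -> H -> 0 with the free
cover F0 -> H, which gives an exact sequence
0 -> Omega H -> G1 x F0 -> G0 -> 0; it stays exact after tensoring with K as
G0 is flat, and G1 (x) K -> G0 (x) K is injective since it embeds in
G1 (x) L -> G0 (x) L. Therefore Omega H (x) K -> F0 (x) K is injective. *)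

Set Implicit Arguments.
Unset Strict Implicit.
Unset Printing Implicit Defensive.
Import GRing.Theory.
Local Open Scope ring_scope.
Local Open Scope quotient_scope.

(** * Vanishing of homology and exactness on elements *)

Lemma quot_pi_eq (A : zmodType) (S : zmodClosed A) (u v : A) :
  u - v \in S -> \pi_(Quotient.quot S) u = \pi_(Quotient.quot S) v.
Proof. by rewrite Quotient.idealrBE => /eqP. Qed.

Lemma homology_eq0 (A B C : zmodType) (f : {additive A -> B})
    (g : {additive B -> C}) :
  is_zero (homology f g) <-> forall b, g b = 0 -> exists a, f a = b.
Proof.
split=> [H0 b gb|H0 x].
  have bK : b \in ker_pred g by apply/eqP.
  have /eqP := H0 (\pi_(Quotient.quot (@boundary_pred _ _ _ f g)) (Kernel bK)).
  by rewrite -(raddf0 (\pi_(Quotient.quot (@boundary_pred _ _ _ f g)))) /=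
     -Quotient.idealrBE subr0 => /asboolP.
rewrite -[x]reprK -[RHS](raddf0 (\pi_(Quotient.quot (@boundary_pred _ _ _ f g)))) /=.
apply: quot_pi_eq; rewrite subr0; apply/asboolP/H0.
by apply/eqP; exact: (valP (repr x)).
Qed.

Lemma kernel_exact (R : pzRingType) (U V : lmodType R) (f : {linear U -> V}) :
  exact_at (val : {linear kernel f -> U}) f.
Proof.
move=> u; split=> [fu|[x <-]]; last by apply/eqP; exact: (valP x).
have uK : u \in ker_pred f by apply/eqP.
by exists (Kernel uK).
Qed.

(** * Induction and universal property for tensor products *)

Section TensorLift.
Variables (R : pzRingType) (H : rmodType R) (N : lmodType R).

(** Tensors are integer combinations of pure ones, and closure under differences yields 0, sums and
    integer multiples. *)
Lemma tensor_ind (P : tensor H N -> Prop) :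
  (forall h x, P (tens h x)) -> (forall u v, P u -> P v -> P (u - v)) ->
  forall t, P t.
Proof.
move=> Pt PB t.
have P0 : P 0 by rewrite -(subrr (tens 0 0)); apply: PB.
have PD u v : P u -> P v -> P (u + v).
  by move=> Pu Pv; rewrite -[v]opprK -[- v]sub0r; apply: (PB) => //; apply: PB.
have PM u n : P u -> P (u *+ n).
  by move=> Pu; elim: n => [|n IH]; rewrite ?mulr0n // mulrS; apply: PD.
rewrite -[t]tensor_reprK; have [A aA] := free_finsupp (tensor_repr t).
rewrite (free_gen_decomp aA) raddf_sum.
apply: (big_ind P) => // [[h x]] _; set c := free_coef _ _.
rewrite -[c]intz scaler_int raddfMz /=.
case: c => n; first by apply: PM; apply: Pt.
by rewrite NegzE mulrNz -[- _]sub0r; apply: PB => //; apply: PM; apply: Pt.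
Qed.

Variables (A : zmodType) (b : H -> N -> A).
Hypothesis bDl : forall h h' x, b (h + h') x = b h x + b h' x.
Hypothesis bDr : forall h x x', b h (x + x') = b h x + b h x'.
Hypothesis bal : forall (r : R) h x, b ((r : R^c) *: h) x = b h (r *: x).

Lemma tensor_lift : exists f : {additive tensor H N -> A},
  forall h x, f (tens h x) = b h x.
Proof.
(* [zmodule A] is [A] as a module over the integers, which makes [free_lift] applicable. *)
pose phi (u : free_mod int (H * N)%type) : A :=
  free_lift (fun p : H * N => b p.1 p.2 : zmodule A) u.
have phi_gen h x : phi (free_gen int (h, x)) = b h x by rewrite /phi free_lift_gen.
have phiB u v : phi (u - v) = phi u - phi v by rewrite /phi raddfB.
have phiD u v : phi (u + v) = phi u + phi v by rewrite /phi raddfD.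
have phi_rel u : tensor_rel u -> phi u = 0.
  elim=> [|v w _ v0 _ w0|h h' x|h x x'|r h x].
  - by rewrite /phi raddf0.
  - by rewrite phiB v0 w0 subrr.
  - by rewrite phiB phiD !phi_gen bDl subrr.
  - by rewrite phiB phiD !phi_gen bDr subrr.
  - by rewrite phiB !phi_gen bal subrr.
pose g (t : tensor H N) : A := phi (tensor_repr t).
have g_pi u : g (tensor_pi u) = phi u.
  by apply/eqP; rewrite -subr_eq0 -phiB; apply/eqP/phi_rel/tensor_repr_pi.
have gB : zmod_morphism g.
  move=> t s; rewrite -[t]tensor_reprK -[s]tensor_reprK -raddfB.
  by rewrite !g_pi phiB.
pose gA : {additive tensor H N -> A} :=
  HB.pack g (GRing.isZmodMorphism.Build _ _ g gB).
by exists gA => h x; rewrite [LHS]g_pi phi_gen.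
Qed.

End TensorLift.

Lemma tens0l (R : pzRingType) (H : rmodType R) (N : lmodType R) (x : N) :
  tens (0 : H) x = 0.
Proof. by apply: (addrI (tens (0:H) x)); rewrite -tens_addl !addr0. Qed.

Lemma tens0r (R : pzRingType) (H : rmodType R) (N : lmodType R) (h : H) :
  tens h (0 : N) = 0.
Proof. by apply: (addrI (tens h (0:N))); rewrite -tens_addr !addr0. Qed.

Lemma tens_subl (R : pzRingType) (H : rmodType R) (N : lmodType R)
    (h h' : H) (x : N) :
  tens (h - h') x = tens h x - tens h' x.
Proof. by apply/eqP; rewrite eq_sym subr_eq -tens_addl subrK. Qed.

Lemma tens_subr (R : pzRingType) (H : rmodType R) (N : lmodType R)
    (h : H) (x x' : N) :
  tens h (x - x') = tens h x - tens h x'.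
Proof. by apply/eqP; rewrite eq_sym subr_eq -tens_addr subrK. Qed.

Lemma tensor_mapB (R : pzRingType) (H H' : rmodType R) (N N' : lmodType R)
    (f : {linear H -> H'}) (g : {linear N -> N'}) :
  zmod_morphism (tensor_map f g).
Proof. exact: raddfB. Qed.

Lemma tensor_map0 (R : pzRingType) (H H' : rmodType R) (N N' : lmodType R)
    (f : {linear H -> H'}) (g : {linear N -> N'}) :
  tensor_map f g 0 = 0.
Proof. exact: raddf0. Qed.

(* [f''] and [g''] are kept separate from the composites [f' \o f], [g' \o g]
   so that either side of a commutative square can be collapsed. *)
Lemma tensor_map_comp (R : pzRingType) (H H' H'' : rmodType R)
    (N N' N'' : lmodType R) (f : {linear H -> H'}) (f' : {linear H' -> H''})
    (f'' : {linear H -> H''}) (g : {linear N -> N'}) (g' : {linear N' -> N''})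
    (g'' : {linear N -> N''}) :
  (forall h, f' (f h) = f'' h) -> (forall x, g' (g x) = g'' x) ->
  forall t, tensor_map f' g' (tensor_map f g t) = tensor_map f'' g'' t.
Proof.
move=> ff gg; elim/tensor_ind=> [h x|u v IHu IHv].
  by rewrite !tensor_map_tens ff gg.
by rewrite !tensor_mapB IHu IHv.
Qed.

(** * Right exactness of the tensor product *)

Section TensorKernel.
Variables (R : pzRingType) (H H' : rmodType R) (N N' : lmodType R).
Variables (p : {linear H -> H'}) (q : {linear N -> N'}).
Hypothesis psurj : forall h', exists h, p h = h'.
Hypothesis qsurj : forall x', exists x, q x = x'.

(* The inverse H' (x) N' -> (H (x) N) / S of the map induced by p (x) q is
   given by lifting both factors of a pure tensor arbitrarily. *)
Lemma tensor_map_ker (S : zmodClosed (tensor H N)) :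
  (forall h x, p h = 0 -> tens h x \in S) ->
  (forall h x, q x = 0 -> tens h x \in S) ->
  forall t, tensor_map p q t = 0 -> t \in S.
Proof.
move=> Sl Sr.
pose pi : {additive _ -> _} := \pi_(Quotient.quot S).
have piS t : pi t = 0 -> t \in S.
  by move=> /eqP; rewrite -(raddf0 pi) /pi /= -Quotient.idealrBE subr0.
have eqS u v : u - v \in S -> pi u = pi v by exact: quot_pi_eq.
pose s h' := sval (cid (psurj h')); pose r x' := sval (cid (qsurj x')).
have ps h' : p (s h') = h' by rewrite /s; case: cid.
have qr x' : q (r x') = x' by rewrite /r; case: cid.
(* Modulo [S] a pure tensor depends only on the images of its factors; this makes the arbitrary
   lifts biadditive and balanced. *)
have eql h1 h2 x : p h1 = p h2 -> pi (tens h1 x) = pi (tens h2 x).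
  move=> h12; apply: eqS; rewrite -tens_subl; apply: Sl.
  by rewrite linearB h12 subrr.
have eqr h x1 x2 : q x1 = q x2 -> pi (tens h x1) = pi (tens h x2).
  move=> h12; apply: eqS; rewrite -tens_subr; apply: Sr.
  by rewrite linearB h12 subrr.
have [|||g gE] := @tensor_lift R H' N' (Quotient.quot S)
    (fun h' x' => pi (tens (s h') (r x'))).
- move=> h1 h2 x; rewrite -raddfD -tens_addl; apply: eql.
  by rewrite linearD !ps.
- move=> h x1 x2; rewrite -raddfD -tens_addr; apply: eqr.
  by rewrite linearD !qr.
- move=> a h x; rewrite (eql _ ((a : R^c) *: s h)); last by rewrite linearZ /= !ps.
  by rewrite tens_bal; apply: eqr; rewrite linearZ /= !qr.
move=> t t0; apply: piS; rewrite -(raddf0 g) -t0.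
elim/tensor_ind: t {t0} => [h x|u v IHu IHv]; last first.
  by rewrite tensor_mapB [LHS]raddfB [RHS]raddfB IHu IHv.
by rewrite tensor_map_tens gE (eql _ (s (p h))) ?ps //; apply: eqr; rewrite qr.
Qed.

End TensorKernel.

Section Image.
Variables (A B : zmodType) (f : {additive A -> B}).

Definition im_pred : {pred B} := [pred b | `[< exists a, f a = b >]].

Lemma im_pred_closed : zmod_closed im_pred.
Proof.
split=> [|x y /asboolP[a <-] /asboolP[b <-]]; apply/asboolP.
  by exists 0; rewrite raddf0.
by exists (a - b); rewrite raddfB.
Qed.

HB.instance Definition _ := GRing.isZmodClosed.Build B im_pred im_pred_closed.

End Image.

(** The image of the left map contains all pure tensors with a factor killed by [p], so it can serve
    as [S] in [tensor_map_ker]. *)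
Lemma tensor_exactr (R : pzRingType) (H : rmodType R) (U V W : lmodType R)
    (i : {linear U -> V}) (p : {linear V -> W}) :
  (forall w, exists v, p v = w) -> exact_at i p ->
  forall t, tensor_map (idfun : {linear H -> H}) p t = 0 ->
  exists s, tensor_map (idfun : {linear H -> H}) i s = t.
Proof.
move=> psurj ex t t0.
suff /asboolP : t \in im_pred (tensor_map (idfun : {linear H -> H}) i) by [].
apply: tensor_map_ker t0 => //; first by move=> h'; exists h'.
  by move=> h x /= ->; rewrite tens0l rpred0.
move=> h x /ex[u <-]; apply/asboolP; exists (tens h u).
exact: tensor_map_tens.
Qed.

Lemma tensor_exactl (R : pzRingType) (U V W : rmodType R) (N : lmodType R)
    (i : {linear U -> V}) (p : {linear V -> W}) :
  (forall w, exists v, p v = w) -> exact_at i p ->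
  forall t, tensor_map p (idfun : {linear N -> N}) t = 0 ->
  exists s, tensor_map i (idfun : {linear N -> N}) s = t.
Proof.
move=> psurj ex t t0.
suff /asboolP : t \in im_pred (tensor_map i (idfun : {linear N -> N})) by [].
apply: tensor_map_ker t0 => //; first by move=> h'; exists h'.
  move=> h x /ex[u <-]; apply/asboolP; exists (tens u x).
  exact: tensor_map_tens.
by move=> h x /= ->; rewrite tens0r rpred0.
Qed.

(** * Tensor products with a free module *)

Section TensorFree.
Variables (R : pzRingType) (X : choiceType).
Local Notation L := (free_mod R X).

(** This is the coordinate at [x] when the tensor product is seen as a direct sum of copies of [A]
    indexed by [X]. *)
Lemma tensor_coef_subproof (A : rmodType R) (x : X) :
  exists f : {additive tensor A L -> A},
    forall a l, f (tens a l) = (free_coef l x : R^c) *: a.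
Proof.
apply: tensor_lift.
- by move=> a a' l; rewrite scalerDr.
- by move=> a l l'; rewrite -scalerDl.
- by move=> r a l; rewrite scalerA.
Qed.

Definition tensor_coef (A : rmodType R) (x : X) : {additive tensor A L -> A} :=
  sval (cid (tensor_coef_subproof A x)).

Lemma tensor_coef_tens (A : rmodType R) (x : X) (a : A) (l : L) :
  tensor_coef A x (tens a l) = (free_coef l x : R^c) *: a.
Proof. by rewrite /tensor_coef; case: cid. Qed.

Lemma tensor_coef_eq0 (A : rmodType R) (t : tensor A L) :
  (forall x, tensor_coef A x t = 0) -> t = 0.
Proof.
(* Allowing every finite [B] above [S] lets both terms of a difference be expanded over one common
   set. *)
have decomp : exists S : {fset X}, forall B : {fset X}, (S `<=` B)%fset ->
    t = \sum_(x <- B) tens (tensor_coef A x t) (free_gen R x).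
  elim/tensor_ind: t => [a l|u v [S uS] [T vT]].
    have [S lS] := free_finsupp l; exists S => B SB.
    have lB x : x \notin B -> free_coef l x = 0.
      by move=> xB; apply: lS; apply: contraNN xB; apply/fsubsetP.
    have dE := free_gen_decomp lB.
    have tens_sum (s : seq X) (F : X -> L) :
        tens a (\sum_(x <- s) F x) = \sum_(x <- s) tens a (F x).
      apply: (big_morph (tens a)); last exact: tens0r.
      by move=> *; apply: tens_addr.
    rewrite {1}dE tens_sum; apply: eq_bigr => x _.
    by rewrite tensor_coef_tens tens_bal.
  exists (S `|` T)%fset => B; rewrite fsubUset => /andP[SB TB].
  rewrite {1}(uS B SB) {1}(vT B TB) -sumrB; apply: eq_bigr => x _.
  by rewrite -tens_subl raddfB.
move=> t0; have [S tS] := decomp; rewrite (tS S (fsubset_refl S)).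
by apply: big1 => x _; rewrite t0 tens0l.
Qed.

(** The induced map acts as [i] on each coordinate. *)
Lemma tensor_free_inj (A B : rmodType R) (i : {linear A -> B}) :
  injective i ->
  forall t, tensor_map i (idfun : {linear L -> L}) t = 0 -> t = 0.
Proof.
move=> i_inj t t0; apply: tensor_coef_eq0 => x; apply: i_inj.
rewrite linear0 -(raddf0 (tensor_coef B x)) -t0 {t0}.
elim/tensor_ind: t => [a l|u v IHu IHv].
  by rewrite tensor_map_tens !tensor_coef_tens linearZ.
by rewrite tensor_mapB [in LHS]raddfB [RHS]raddfB -IHu -IHv linearB.
Qed.

End TensorFree.

(* Tensor with 0 -> K' -> L -> K -> 0, where L is free, and chase. *)
Lemma tensor_flat_coker_inj (R : pzRingType) (A B G : rmodType R)
    (f : {linear A -> B}) (g : {linear B -> G}) (K : lmodType R) :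
  flat G -> injective f -> exact_at f g -> (forall y, exists b, g b = y) ->
  forall t, tensor_map f (idfun : {linear K -> K}) t = 0 -> t = 0.
Proof.
move=> flatG finj ex gsurj t t0.
pose i : {linear syz K -> free_mod R K} := val.
pose p := free_cover K.
have exK : exact_at i p by exact: kernel_exact.
have [z zE] : exists z, tensor_map (idfun : {linear A -> A}) p z = t.
  elim/tensor_ind: {t0} t => [a x|u v [y <-] [z <-]].
    have [l lx] := free_cover_surj x.
    by exists (tens a l); rewrite tensor_map_tens -lx.
  by exists (y - z); rewrite tensor_mapB.
have [x xE] : exists x, tensor_map (idfun : {linear B -> B}) i x =
    tensor_map f (idfun : {linear free_mod R K -> free_mod R K}) z.
  apply: (tensor_exactr (@free_cover_surj R K) exK); rewrite -t0 -zE.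
  by rewrite !(@tensor_map_comp _ _ _ _ _ _ _ _ _ f _ _ p).
(* Flatness of [G] allows a check in the product with the free module, where [x] becomes the image
   of [z] under [g] after [f], which is 0. *)
have gx0 : tensor_map g (idfun : {linear syz K -> syz K}) x = 0.
  apply: (flatG _ _ i val_inj); rewrite tensor_map0.
  rewrite (@tensor_map_comp _ _ _ _ _ _ _ _ _ g _ _ i) //.
  rewrite -(@tensor_map_comp _ _ B _ _ _ _ idfun g _ i idfun) // xE.
  rewrite (@tensor_map_comp _ _ _ _ _ _ _ f g \0 idfun idfun idfun) //; last first.
    by move=> a; apply/ex; exists a.
  elim/tensor_ind: z {zE xE} => [a l|u v IHu IHv].
    by rewrite tensor_map_tens tens0l.
  by rewrite tensor_mapB IHu IHv subrr.
have [y yE] := tensor_exactl gsurj ex gx0.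
(* The image of [y] under [i] agrees with [z] after applying [f], hence equals [z]; it dies in the
   product with [K]. *)
rewrite -zE -[z](subrK (tensor_map (idfun : {linear A -> A}) i y)).
have /eqP -> : z - tensor_map (idfun : {linear A -> A}) i y == 0.
  apply/eqP; apply: (tensor_free_inj finj); rewrite tensor_mapB -xE -yE.
  by rewrite !(@tensor_map_comp _ _ _ _ _ _ _ _ _ f _ _ i) // subrr.
rewrite add0r (@tensor_map_comp _ _ _ _ _ _ _ idfun idfun idfun i p \0) //; last first.
  by move=> u; apply/exK; exists u.
elim/tensor_ind: y {yE} => [a l|u v IHu IHv].
  by rewrite tensor_map_tens tens0r.
by rewrite tensor_mapB IHu IHv subrr.
Qed.

Section LinearPair.
Variables (R : pzRingType) (U V W : lmodType R).
Variables (f : {linear U -> V}) (g : {linear U -> W}).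

Definition lin_pair (u : U) : V * W := (f u, g u).

Lemma lin_pair_linear : linear lin_pair.
Proof. by move=> a u v; rewrite /lin_pair !linearP. Qed.

HB.instance Definition _ :=
  GRing.isLinear.Build R U (V * W)%type _ lin_pair lin_pair_linear.

End LinearPair.

(** The identity of [A * B] is the sum of the projections followed by the injections, so [t] is
    recovered from its two images. *)
Lemma tensor_pair_eq0 (R : pzRingType) (A B : rmodType R) (K : lmodType R)
    (t : tensor (A * B)%type K) :
  tensor_map (fst : {linear (A * B)%type -> A}) (idfun : {linear K -> K}) t = 0 ->
  tensor_map (snd : {linear (A * B)%type -> B}) (idfun : {linear K -> K}) t = 0 ->
  t = 0.
Proof.
move=> t1 t2.
pose i1 : {linear A -> (A * B)%type} := lin_pair idfun \0.
pose i2 : {linear B -> (A * B)%type} := lin_pair \0 idfun.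
rewrite -[RHS]addr0 -{1}(tensor_map0 i1 (idfun : {linear K -> K})) -{1}t1.
rewrite -(tensor_map0 i2 (idfun : {linear K -> K})) -{1}t2 {t1 t2}.
elim/tensor_ind: t => [[a b] x|u v IHu IHv].
  rewrite !tensor_map_tens -tens_addl /= -[i1 a + i2 b]/(a + 0, 0 + b).
  by rewrite addr0 add0r.
by rewrite !tensor_mapB {1}IHu {1}IHv opprD addrACA.
Qed.

Lemma exact_inj (R : pzRingType) (U V W : lmodType R) (f : {linear U -> V})
    (g : {linear V -> W}) :
  (forall u : U, u = 0) -> exact_at f g -> injective g.
Proof.
move=> U0 ex x y gxy; apply/eqP; rewrite -subr_eq0; apply/eqP.
have /ex[u <-] : g (x - y) = 0 by rewrite linearB gxy subrr.
by rewrite (U0 u) linear0.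
Qed.


(** * Submodules of free modules and [F1_flat] *)

Section SubmoduleOfFree.
Variables (R : pzRingType) (X : choiceType) (K : lmodType R).
Variables (iota : {linear K -> free_mod R X}) (iota_inj : injective iota).

(** Flatness of [A] embeds its product with [K] in that with the free module, on which [f] stays
    injective. *)
Lemma tensor_flat_inj_sub (A B : rmodType R) (f : {linear A -> B}) :
  flat A -> injective f ->
  forall t, tensor_map f (idfun : {linear K -> K}) t = 0 -> t = 0.
Proof.
move=> flatA finj t t0; apply: (flatA _ _ iota iota_inj); rewrite tensor_map0.
apply: (tensor_free_inj finj).
rewrite (@tensor_map_comp _ _ _ _ _ _ _ _ _ f _ _ iota) //.
rewrite -(@tensor_map_comp _ _ B _ _ _ _ f idfun f idfun iota iota) //.
by rewrite t0 tensor_map0.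
Qed.

(* With a flat resolution 0 -> G1 -> G0 -> H -> 0 and F0 -> H the free cover,
   comparing the two resolutions gives an exact sequence
   0 -> syz H -> G1 x F0 -> G0 -> 0. *)
Lemma tensor_syz_inj (H : rmodType R) :
  fd_le H 1 ->
  forall t, tensor_map (val : {linear syz H -> free_mod R^c H})
    (idfun : {linear K -> K}) t = 0 -> t = 0.
Proof.
move=> [G [Gflat G0]] t t0.
pose j : {linear syz H -> free_mod R^c H} := val.
pose d : {linear G 1%N -> G 0%N} := res_d G 0.
(* The flat resolution vanishes in degree 2. *)
have dinj : injective d := exact_inj (G0 2%N isT) (@res_exact _ _ G 0).
have [phi0 phi0E] : exists phi0 : {linear free_mod R^c H -> G 0%N},
    forall a, res_aug G (phi0 a) = free_cover H a.
  by apply: free_mod_projective; apply: res_aug_surj.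
have phi1_ex z : exists u, d u = phi0 (j z).
  by apply/(@res_exact0 _ _ G); rewrite phi0E; apply/eqP; exact: (valP z).
(* Values are chosen pointwise; injectivity of [d] makes the choice linear. *)
pose phi1f z := sval (cid (phi1_ex z)).
have phi1fE z : d (phi1f z) = phi0 (j z) by rewrite /phi1f; case: cid.
have phi1_lin : linear phi1f.
  by move=> a u v; apply: dinj; rewrite linearP !phi1fE !linearP.
pose phi1 : {linear syz H -> G 1%N} :=
  HB.pack phi1f (GRing.isLinear.Build _ _ _ _ phi1f phi1_lin).
have phi1E z : d (phi1 z) = phi0 (j z) by exact: phi1fE.
pose f : {linear syz H -> (G 1%N * free_mod R^c H)%type} := lin_pair phi1 j.
pose g : {linear (G 1%N * free_mod R^c H)%type -> G 0%N} :=
  (d \o fst) \- (phi0 \o snd).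
have gE u a : g (u, a) = d u - phi0 a by [].
apply: (@tensor_flat_coker_inj _ _ _ _ f g K (Gflat 0%N)).
- by move=> x y [_ /val_inj].
- move=> [u a]; rewrite gE; split=> [/eqP|[z [<- <-]]]; last first.
    by rewrite phi1E subrr.
  rewrite subr_eq0 => /eqP ua.
  have aK : a \in ker_pred (free_cover H).
    apply/eqP; apply: etrans (esym (phi0E a)) _; rewrite -ua.
    by apply/(@res_exact0 _ _ G); exists u.
  exists (Kernel aK); congr pair; apply: dinj.
  by rewrite phi1E ua.
- move=> y; have [a aE] := free_cover_surj (res_aug G y).
  have /(@res_exact0 _ _ G)[u uE] : res_aug G (y + phi0 (- a)) = 0.
    by rewrite linearD phi0E linearN aE subrr.
  exists (u, - a); rewrite gE; apply/eqP; rewrite subr_eq; apply/eqP; exact: uE.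
(* The free component is 0 by [t0]. The other one is sent by [d] to the image of [t] under
   [phi0 \o j], which is 0, and [d] stays injective after tensoring with [K]. *)
apply: tensor_pair_eq0.
  rewrite (@tensor_map_comp _ _ _ _ _ _ _ f fst phi1 idfun idfun idfun) //.
  apply: (tensor_flat_inj_sub (Gflat 1%N) dinj).
  rewrite -(tensor_map0 phi0 (idfun : {linear K -> K})) -t0.
  rewrite (@tensor_map_comp _ _ _ _ _ _ _ phi1 d (phi0 \o j) idfun idfun idfun) //.
  by rewrite (@tensor_map_comp _ _ _ _ _ _ _ j phi0 (phi0 \o j) idfun idfun idfun).
by rewrite (@tensor_map_comp _ _ _ _ _ _ _ f snd j idfun idfun idfun).
Qed.

(** The differential factors as the cover [e] followed by the inclusion [j]. As [j] stays injective
    by [tensor_syz_inj], a cycle dies under [e], and right exactness makes it a boundary. *)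
Lemma F1_flat_sub_free : F1_flat K.
Proof.
move=> H fdH; apply/homology_eq0 => t t0.
pose j : {linear syz H -> free_mod R^c H} := val.
pose e := free_cover (syz H).
apply: (@tensor_exactl _ _ _ _ K _ e (@free_cover_surj _ _)).
  exact: syz_exact.
apply: (tensor_syz_inj fdH); rewrite -[RHS]t0.
rewrite (@tensor_map_comp _ _ _ _ _ _ _ e j (res_d (free_resolution H) 0)
  idfun idfun idfun) //.
Qed.

End SubmoduleOfFree.

(** * Comparison of projective resolutions *)

Lemma exact_comp0 (R : pzRingType) (U V W : lmodType R) (f : {linear U -> V})
    (g : {linear V -> W}) :
  exact_at f g -> forall u, g (f u) = 0.
Proof. by move=> ex u; apply/ex; exists u. Qed.

(** Exactness makes [f] surjective onto [kernel g], through which [h] factors. *)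
Lemma projective_lift_exact (R : pzRingType) (P U V W : lmodType R)
    (f : {linear U -> V}) (g : {linear V -> W}) (h : {linear P -> V}) :
  projective P -> exact_at f g -> (forall x, g (h x) = 0) ->
  exists k : {linear P -> U}, forall x, f (k x) = h x.
Proof.
move=> projP ex gh.
have fK u : f u \in ker_pred g by apply/eqP; apply: (exact_comp0 ex).
have hK x : h x \in ker_pred g by apply/eqP; apply: gh.
pose f1 u : kernel g := Kernel (fK u); pose h1 x : kernel g := Kernel (hK x).
have f1_lin : linear f1 by move=> a u v; apply: val_inj; exact: linearP.
have h1_lin : linear h1 by move=> a u v; apply: val_inj; exact: linearP.
pose f' : {linear U -> kernel g} :=
  HB.pack f1 (GRing.isLinear.Build _ _ _ _ f1 f1_lin).
pose h' : {linear P -> kernel g} :=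
  HB.pack h1 (GRing.isLinear.Build _ _ _ _ h1 h1_lin).
have [|k kE] := projP _ _ f' h'.
  move=> v; have /ex[u uE] : g (val v) = 0 by apply/eqP; exact: (valP v).
  by exists u; apply: val_inj.
by exists k => x; exact: (congr1 val (kE x)).
Qed.

(** Serves to build maps degree by degree; [I] is the invariant that makes the next step
    possible. *)
Lemma dependent_choice_nat (T : nat -> Type) (I : forall i, T i -> Prop)
    (r : forall i, T i -> T i.+1 -> Prop) :
  (exists t, I 0%N t) ->
  (forall i t, I i t -> exists t', r i t t' /\ I i.+1 t') ->
  exists s : forall i, T i, I 0%N (s 0%N) /\ forall i, r i (s i) (s i.+1).
Proof.
move=> /cid[t0 It0] step.
pose next i (t : {t | I i t}) : {t' | I i.+1 t'} :=
  let c := cid (step i (sval t) (svalP t)) in exist _ (sval c) (svalP c).2.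
pose s := nat_rect (fun i => {t | I i t}) (exist _ t0 It0) next.
exists (fun i => sval (s i)); split=> [//|i].
exact: (svalP (cid (step i _ (svalP (s i))))).1.
Qed.

Section Comparison.
Variables (R : pzRingType) (M : lmodType R) (P Q : resolution M).
Hypothesis projP : forall i, projective (P i).

Lemma comparison_map : exists phi : forall i, {linear P i -> Q i},
  (forall x, res_aug Q (phi 0%N x) = res_aug P x) /\
  forall i x, res_d Q i (phi i.+1 x) = phi i (res_d P i x).
Proof.
(* In positive degree the invariant says that the next map to be lifted lands in a kernel; it
   mentions only the last map built. *)
pose I i : {linear P i -> Q i} -> Prop :=
  match i with
  | 0%N => fun a => forall x, res_aug Q (a x) = res_aug P x
  | j.+1 => fun a => forall x, res_d Q j (a (res_d P j.+1 x)) = 0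
  end.
apply: (@dependent_choice_nat _ I
  (fun i a b => forall x, res_d Q i (b x) = a (res_d P i x))).
  by apply: projP; apply: res_aug_surj.
move=> i a Ia.
suff [b bE] : exists b : {linear P i.+1 -> Q i.+1},
    forall x, res_d Q i (b x) = (a \o res_d P i) x.
  exists b; split=> [//|x /=].
  by rewrite bE /= (exact_comp0 (@res_exact _ _ P i)) linear0.
case: i a Ia => [|i] a Ia.
  apply: (projective_lift_exact (@projP _) (@res_exact0 _ _ Q)) => x /=.
  by rewrite Ia; apply: (exact_comp0 (@res_exact0 _ _ P)).
by apply: (projective_lift_exact (@projP _) (@res_exact _ _ Q i)) => x; apply: Ia.
Qed.

Lemma nullhomotopic (delta : forall i, {linear P i -> Q i}) :
  (forall x, res_aug Q (delta 0%N x) = 0) ->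
  (forall i x, res_d Q i (delta i.+1 x) = delta i (res_d P i x)) ->
  exists s : forall i, {linear P i -> Q i.+1}, forall i x,
    delta i.+1 x = res_d Q i.+1 (s i.+1 x) + s i (res_d P i x).
Proof.
move=> delta0 deltaS.
(* The defect left by [s] in the next degree is a cycle, so it lifts through the next
   differential. *)
pose I i (s : {linear P i -> Q i.+1}) :=
  forall x, res_d Q i (delta i.+1 x - s (res_d P i x)) = 0.
pose r i (s : {linear P i -> Q i.+1}) (s' : {linear P i.+1 -> Q i.+2}) :=
  forall x, res_d Q i.+1 (s' x) = delta i.+1 x - s (res_d P i x).
suff [s [_ sE]] : exists s : forall i, {linear P i -> Q i.+1},
    I 0%N (s 0%N) /\ forall i, r i (s i) (s i.+1).
  by exists s => i x; rewrite sE subrK.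
apply: dependent_choice_nat => [|i s Is].
  have [s sE] := projective_lift_exact (@projP _) (@res_exact0 _ _ Q) delta0.
  by exists s => x; rewrite linearB sE deltaS subrr.
have [s' s'E] := @projective_lift_exact _ _ _ _ _ _ _
  (delta i.+1 \- (s \o res_d P i)) (@projP _) (@res_exact _ _ Q i) Is.
exists s'; split=> // x.
rewrite linearB s'E /= deltaS (exact_comp0 (@res_exact _ _ P i)) linear0 subr0.
by rewrite subrr.
Qed.

End Comparison.

(** The composite from [P] to [Q] and back is homotopic to the identity, and it vanishes in degree
    [n.+1] with [Q]. *)
Lemma contraction_in_degree (R : pzRingType) (M : lmodType R)
    (P Q : resolution M) (n : nat) :
  (forall i, projective (P i)) -> (forall i, projective (Q i)) ->
  (forall x : Q n.+1, x = 0) ->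
  exists (s : {linear P n -> P n.+1}) (s' : {linear P n.+1 -> P n.+2}),
    forall x, x = res_d P n.+1 (s' x) + s (res_d P n x).
Proof.
move=> projP projQ Q0.
have [phi [phi0 phiS]] := comparison_map Q projP.
have [psi [psi0 psiS]] := comparison_map P projQ.
have [||s sE] := @nullhomotopic _ _ P P projP (fun i => idfun \- (psi i \o phi i)).
- by move=> x; rewrite linearB /= psi0 phi0 subrr.
- by move=> i x; rewrite linearB /= psiS phiS.
exists (s n), (s n.+1) => x.
by rewrite -sE /= (Q0 (phi n.+1 x)) linear0 subr0.
Qed.

(** * Vanishing of [Ext] in terms of cocycles *)

Section ExtVanishing.
Variables (R : pzRingType) (M N : lmodType R) (n : nat).
Local Notation F := (free_resolution M).

Lemma linhom_of_linear (U V : lmodType R) (g : {linear U -> V}) :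
  exists h : linhom U V, forall x, h x = g x.
Proof.
have gP : (g : U -> V) \in @hom_pred R U V by apply/asboolP; exact: linearP.
by exists (LinHom gP).
Qed.

Lemma Ext_eq0 : is_zero (Ext M N n.+1) <->
  forall f : {linear F n.+1 -> N}, (forall x, f (res_d F n.+1 x) = 0) ->
  exists g : {linear F n -> N}, forall x, g (res_d F n x) = f x.
Proof.
rewrite [is_zero _]homology_eq0; split=> [H f f0|H f f0].
  have [h hE] := linhom_of_linear f.
  have [|g gE] := H h.
    by apply: val_inj; apply/funext => x /=; rewrite hE f0.
  exists g => x; rewrite -hE.
  exact: (congr1 (fun k : linhom (F n.+1) N => k x) gE).
have [|g gE] := H f.
  by move=> x; exact: (congr1 (fun k : linhom (F n.+2) N => k x) f0).
have [h hE] := linhom_of_linear g.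
by exists h; apply: val_inj; apply/funext => x /=; rewrite hE gE.
Qed.

(** A cocycle [f] kills the first summand of the contraction, which leaves [f] as the coboundary of
    [f \o s]. *)
Lemma pd_le_Ext_eq0 : pd_le M n -> is_zero (Ext M N n.+1).
Proof.
move=> [P [projP P0]]; apply/Ext_eq0 => f f0.
have projF i : projective (F i) by exact: free_mod_projective.
have [s [s' sE]] := contraction_in_degree projF projP (P0 n.+1 (ltnSn n)).
by exists (f \o s) => x; rewrite [in RHS](sE x) linearD f0 add0r.
Qed.

End ExtVanishing.

(** * Projective dimension through syzygies *)

Lemma projective_iter_syz_pd_le (R : pzRingType) (n : nat) (M : lmodType R) :
  projective (iter n (@syz R) M) -> pd_le M n.
Proof.
elim: n M => [|n IHn] M.
  move=> projM; pose Z : lmodType R := 'rV[R]_0.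
  have Z0 (z : Z) : z = 0 by apply/rowP; case.
  pose obj i : lmodType R := if i is 0%N then M else Z.
  pose d i : {linear obj i.+1 -> obj i} := \0.
  have dex i : exact_at (d i.+1) (d i).
    by move=> v; split=> _; [exists 0; rewrite [RHS]Z0|].
  have augS : forall m : M, exists x, (idfun : {linear M -> M}) x = m.
    by move=> m; exists m.
  have dex0 : exact_at (d 0%N) (idfun : {linear obj 0%N -> M}).
    by move=> v; split=> [/= ->|[u <-]]; first by exists 0.
  exists (@Resolution R M obj d idfun augS dex0 dex); split; last by case.
  case=> [//|i] U V p f psurj; exists \0 => x.
  by rewrite (Z0 x) !linear0.
(* The innermost syzygy is peeled off: a resolution of [syz M], shifted by one degree, is spliced
   with the free cover of [M]. *)
rewrite iterSr => /IHn[P [projP P0]].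
pose obj i : lmodType R := if i is j.+1 then P j else free_mod R M.
pose d i : {linear obj i.+1 -> obj i} :=
  match i with
  | 0%N => (val : {linear syz M -> free_mod R M}) \o res_aug P
  | j.+1 => res_d P j
  end.
have dex0 : exact_at (d 0%N) (free_cover M).
  move=> v; rewrite (kernel_exact (free_cover M) v); split=> [[y <-]|[u <-]].
    by have [u <-] := res_aug_surj P y; exists u.
  by exists (res_aug P u).
have dex i : exact_at (d i.+1) (d i).
  case: i => [|i]; last exact: (@res_exact _ _ P i).
  move=> v; split=> [v0|/(@res_exact0 _ _ P) v0]; last by rewrite /= [X in val X]v0.
  by apply/(@res_exact0 _ _ P); apply: val_inj.
exists (@Resolution R M obj d (free_cover M) (@free_cover_surj R M) dex0 dex).
split=> [[|i]|[//|i] ni]; [exact: free_mod_projective|exact: projP|].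
exact: P0.
Qed.

(** The retraction splits the free cover, so [M] is a direct summand of a free module. *)
Lemma syz_retract_projective (R : pzRingType) (M : lmodType R)
    (g : {linear free_mod R M -> syz M}) :
  (forall y, g (val y) = y) -> projective M.
Proof.
move=> gK U V p f psurj.
pose c := free_cover M; pose i : {linear syz M -> free_mod R M} := val.
have ci y : c (i y) = 0 by apply/eqP; exact: (valP y).
have [h hE] := free_mod_projective (f \o c) psurj.
pose t : {linear free_mod R M -> free_mod R M} := idfun \- (i \o g).
have t_ker x : c x = 0 -> t x = 0.
  move=> /eqP xK; apply/eqP; rewrite subr_eq0 /=.
  by rewrite [g x](gK (Kernel xK)).
(* [free_gen] is a set-theoretic section of [c]; its failure to be linear lies in the kernel of [c],
   which [t] kills. *)
pose s u := t (free_gen R u).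
have cs u : c (s u) = u.
  by rewrite /s linearB /= [X in _ - X]ci subr0; exact: free_lift_gen.
have s_lin : linear s.
  move=> a u v; apply/eqP; rewrite -subr_eq0 /s -linearP -linearB; apply/eqP/t_ker.
  by rewrite linearB linearP /= !free_lift_gen subrr.
pose s' : {linear M -> free_mod R M} :=
  HB.pack s (GRing.isLinear.Build _ _ _ _ s s_lin).
exists (h \o s') => u /=.
by rewrite hE /= [X in f X]cs.
Qed.

Lemma Ext_iter_syz_eq0_pd_le (R : pzRingType) (M : lmodType R) (n : nat) :
  is_zero (Ext M (iter n.+1 (@syz R) M) n.+1) -> pd_le M n.
Proof.
move=> /Ext_eq0 H.
pose K := iter n.+1 (@syz R) M.
(* The resolution is free on [K] in degree [n.+1], and the next differential lands in the kernel of
   this cover. *)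
have [|g gE] := H (free_cover K).
  by move=> x; apply/eqP; exact: (valP (free_cover (syz K) x)).
apply: projective_iter_syz_pd_le; apply: (syz_retract_projective (g := g)) => y.
(* Once [y] is the cover of [x], its inclusion is the differential of [x]. *)
have [x <-] := free_cover_surj y; exact: gE.
Qed.

Theorem proposition4p1 (R : pzRingType) (M : lmodType R) (n : nat)
    (hn : (1 <= n)%N) :
  (pd_le M n <->
     forall N : lmodType R, F1_flat N -> is_zero (Ext M N n.+1)) /\
  (pd_le M n <->
     forall N : lmodType R, F1_fp_flat N -> is_zero (Ext M N n.+1)).
Proof.
(* The outermost syzygy is a kernel inside a free module. *)
have F1_flatK : F1_flat (iter n.+1 (@syz R) M).
  by apply: (@F1_flat_sub_free _ _ _ \val); exact: val_inj.
split; split.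
- by move=> pdM N _; apply: pd_le_Ext_eq0.
- by move=> H; apply: Ext_iter_syz_eq0_pd_le; apply: H.
- by move=> pdM N _; apply: pd_le_Ext_eq0.
(* [F1_fp] lies in [F1], so the same syzygy is also [F1_fp_flat]. *)
- move=> H; apply: Ext_iter_syz_eq0_pd_le; apply: H => G [FG _].
  exact: F1_flatK.
Qed.
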